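(* Let $a_1,a_2,a_3$ be positive integers with $\gcd(a_1,a_2,a_3)=1$, let $k$ be a field, and let $R=k[t^{a_1},t^{a_2},t^{a_3}]\subseteq k[t]$. Suppose that $R$ is not Gorenstein. Let $\varphi:k[X,Y,Z]\to R$ be the $k$-algebra homomorphism with $\varphi(X)=t^{a_1}$, $\varphi(Y)=t^{a_2}$, $\varphi(Z)=t^{a_3}$, and let $\alpha,\beta,\gamma,\alpha',\beta',\gamma'$ be positive integers such that $$\operatorname{Ker}\varphi=I_2\begin{pmatrix}X^{\alpha}&Y^{\beta}&Z^{\gamma}\\ Y^{\beta'}&Z^{\gamma'}&X^{\alpha'}\end{pmatrix}.$$ Suppose that $a_1\alpha$ is the smallest integer among $a_1\alpha,\ a_2\beta,\ a_3\gamma,\ a_2\beta',\ a_3\gamma'$, and $a_1\alpha'$. Then $h(\omega_R)=\alpha\beta'(\gamma+\gamma')$.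
   Context: $I_2(\mathbb{M})$ is the ideal generated by the $2\times 2$ minors of the matrix $\mathbb{M}$. (By a theorem of Herzog, when $R$ is not Gorenstein, $\operatorname{Ker}\varphi$ always has the displayed form for some positive integers.) $\omega_R$ is the (graded) canonical module of $R$, i.e. $\omega_R\cong\operatorname{Ext}^2_P(R,\omega_P)$ with $P=k[X,Y,Z]$ graded by $\deg X=a_1,\deg Y=a_2,\deg Z=a_3$ and $\omega_P$ the graded canonical module of $P$ (a graded shift of $P$); it is regarded as an $R$-module, forgetting the grading. For a finitely generated $R$-module $M$, $h(M)=\inf\{\ell_R(R/\operatorname{Im} f)\mid f\in\operatorname{Hom}_R(M,R)\}$, where $\ell_R$ is length. *)

(* Defs.v *)
From HB Require Import structures.
From mathcomp Require Import all_boot all_order all_algebra.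
From mathcomp Require Import ring_quotient generic_quotient.
From mathcomp Require Import boolp mpoly.

Set Implicit Arguments.
Unset Strict Implicit.
Unset Printing Implicit Defensive.

Import GRing.Theory.
Local Open Scope ring_scope.
Local Open Scope quotient_scope.

(* Extended natural numbers are encoded in [option nat], [None] standing for
   infinity. *)
Definition enat_sup (A : nat -> Prop) : option nat :=
  match pselect (exists b, `[< forall n, A n -> (n <= b)%N >]) with
  | left bounded => Some (ex_minn bounded)
  | right _ => None
  end.

Definition enat_inf (A : option nat -> Prop) : option nat :=
  match pselect (exists n, `[< A (Some n) >]) with
  | left finite => Some (ex_minn finite)
  | right _ => None
  end.

Section QuotientModule.
Variables (R : comNzRingType) (V : lmodType R) (N : submodClosed V).

Lemma submod_zmod_closed : zmod_closed N.
Proof. exact: GRing.submod_closedB (submodClosedP N). Qed.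

(* A copy of [N] carrying the additive subgroup structure which the quotient
   construction requires. *)
Definition submod_zmod : {pred V} := N.
HB.instance Definition _ := GRing.isZmodClosed.Build V submod_zmod
  submod_zmod_closed.

Definition quotmod : Type := Quotient.quot submod_zmod.
HB.instance Definition _ := GRing.Zmodule.on quotmod.
HB.instance Definition _ := EqQuotient.on quotmod.

Definition quotmod_pi (x : V) : quotmod := \pi_(Quotient.quot submod_zmod) x.

Definition quotmod_scale (a : R) (q : quotmod) : quotmod :=
  quotmod_pi (a *: repr q).

Lemma quotmod_piP x y : quotmod_pi x = quotmod_pi y <-> x - y \in N.
Proof.
by split=> [/eqP|Nxy]; [|apply/eqP]; rewrite -[_ == _]Quotient.idealrBE.
Qed.

Lemma quotmod_pi_repr q : quotmod_pi (repr q) = q.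
Proof. exact: reprK. Qed.

Lemma quotmod_piD x y : quotmod_pi (x + y) = quotmod_pi x + quotmod_pi y.
Proof. exact: Quotient.pi_add. Qed.

Lemma quotmod_piZ a x : quotmod_pi (a *: x) = quotmod_scale a (quotmod_pi x).
Proof.
apply/quotmod_piP; rewrite -scalerBr; apply: rpredZ.
by apply/quotmod_piP; rewrite quotmod_pi_repr.
Qed.

Lemma quotmod_scaleA a b q :
  quotmod_scale a (quotmod_scale b q) = quotmod_scale (a * b) q.
Proof. by rewrite -[q]quotmod_pi_repr -!quotmod_piZ scalerA. Qed.

Lemma quotmod_scale1 : left_id 1 quotmod_scale.
Proof. by move=> q; rewrite -[q]quotmod_pi_repr -quotmod_piZ scale1r. Qed.

Lemma quotmod_scaleDr : right_distributive quotmod_scale +%R.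
Proof.
move=> a p q; rewrite -[p]quotmod_pi_repr -[q]quotmod_pi_repr.
by rewrite -quotmod_piD -!quotmod_piZ -quotmod_piD scalerDr.
Qed.

Lemma quotmod_scaleDl q : {morph quotmod_scale^~ q : a b / a + b}.
Proof.
move=> a b; rewrite -[q]quotmod_pi_repr.
by rewrite -!quotmod_piZ -quotmod_piD scalerDl.
Qed.

HB.instance Definition _ := GRing.Zmodule_isLmodule.Build R quotmod
  quotmod_scaleA quotmod_scale1 quotmod_scaleDr quotmod_scaleDl.

End QuotientModule.

Section LinearImage.
Variables (R : comNzRingType) (U V : lmodType R) (f : {linear U -> V}).

Definition linimage : {pred V} := [pred y | `[< exists x, y = f x >]].

Lemma linimage_submod : submod_closed linimage.
Proof.
split=> [|a _ _ /asboolP[x ->] /asboolP[y ->]]; apply/asboolP.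
  by exists 0; rewrite linear0.
by exists (a *: x + y); rewrite linearP.
Qed.

HB.instance Definition _ := GRing.isSubmodClosed.Build R V linimage
  linimage_submod.

End LinearImage.

Section Modules.
Variable R : comNzRingType.
Implicit Types M : lmodType R.

Definition submod_lt M (N N' : submodClosed M) : Prop :=
  {subset N <= N'} /\ exists2 x, x \in N' & x \notin N.

Definition module_length M : option nat :=
  enat_sup (fun n => exists N : nat -> submodClosed M,
    forall i, (i < n)%N -> submod_lt (N i) (N i.+1)).

(* [h(M)], the infimum of the lengths of the [R / Im f], [f : M -> R]. *)
Definition h_invariant M : option nat :=
  enat_inf (fun l => exists f : {linear M -> R^o},
    l = module_length (quotmod (linimage f))).

Definition submod_gen M (G : M -> Prop) (x : M) : Prop :=
  forall N : submodClosed M, (forall y, G y -> y \in N) -> x \in N.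

End Modules.

Section Ideals.
Variable R : comNzRingType.

Definition ideal_gen (G : R -> Prop) : R -> Prop := @submod_gen R R^o G.

Definition is_minor t m n (A : 'M[R]_(m, n)) (x : R) : Prop :=
  exists (f : 'I_t -> 'I_m) (g : 'I_t -> 'I_n),
    [/\ {homo f : i j / (i < j)%N}, {homo g : i j / (i < j)%N} &
        x = \det (mxsub f g A)].

Definition minor_ideal t m n (A : 'M[R]_(m, n)) : R -> Prop :=
  ideal_gen (is_minor t A).

Definition noetherian : Prop :=
  forall I : submodClosed R^o, exists s : seq R,
    forall x, x \in I <-> ideal_gen (fun y => y \in s) x.

Definition maximal_ideal (m : submodClosed R^o) : Prop :=
  1 \notin m /\
  forall I : submodClosed R^o, 1 \notin I -> {subset m <= I} -> I =i m.

(* [f] exhibits [S] as the localization of [R] at the complement of [m]. *)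
Definition is_localization (m : submodClosed R^o) (S : comNzRingType)
    (f : {rmorphism R -> S}) : Prop :=
  [/\ forall s, s \notin m -> exists u, f s * u = 1,
      forall y, exists a s, s \notin m /\ y * f s = f a &
      forall a, f a = 0 -> exists2 s, s \notin m & s * a = 0].

Definition injective_module (E : lmodType R) : Prop :=
  forall (A B : lmodType R) (i : {linear A -> B}) (g : {linear A -> E}),
    injective i -> exists h : {linear B -> E}, forall x, h (i x) = g x.

Definition finite_injdim (M : lmodType R) : Prop :=
  exists (E : nat -> lmodType R) (eta : {linear M -> E 0})
         (d : forall i, {linear E i -> E i.+1}),
    [/\ forall i, injective_module (E i),
        injective eta,
        forall x, d 0 x = 0 <-> exists y, x = eta y,
        forall i x, d i.+1 x = 0 <-> exists y, x = d i y &
        exists n, forall i (x : E i), (n < i)%N -> x = 0].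

End Ideals.

(* A Noetherian ring all of whose localizations at maximal ideals have finite
   injective dimension over themselves. *)
Definition gorenstein (R : comNzRingType) : Prop :=
  noetherian R /\
  forall (m : submodClosed R^o), maximal_ideal m ->
  forall (S : comNzRingType) (f : {rmorphism R -> S}),
    is_localization m f -> finite_injdim S^o.

Section Ext2.
Variables (P R : comNzRingType) (phi : {rmorphism P -> R}).

(* Resolutions of [R], viewed as a [P]-module through [phi], by free
   [P]-modules of finite rank; elements are row vectors and differentials act
   by multiplication on the right. *)
Record free_resolution := FreeResolution {
  fr_rank : nat -> nat;
  fr_diff : forall i, 'M[P]_(fr_rank i.+1, fr_rank i);
  fr_aug : 'rV[P]_(fr_rank 0) -> R;
  fr_aug_linear : forall a u v, fr_aug (a *: u + v) = phi a * fr_aug u + fr_aug v;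
  fr_aug_surj : forall r, exists v, fr_aug v = r;
  fr_exact0 : forall v, fr_aug v = 0 <-> exists w, v = w *m fr_diff 0;
  fr_exactS : forall i (v : 'rV[P]_(fr_rank i.+1)),
    v *m fr_diff i = 0 <-> exists w, v = w *m fr_diff i.+1
}.

(* [E] is isomorphic to [Ext^2_P(R, P)].  Identifying [Hom_P(P^n, P)] with
   column vectors, the dual complex has the maps [c |-> fr_diff i *m c];
   [theta] induces an isomorphism from its second cohomology to [E].  The
   [R]-module structure of [Ext^2_P(R, P)] is the one induced by its
   [P]-module structure, so linearity is expressed through [phi]. *)
Definition is_Ext2 (E : lmodType R) : Prop :=
  exists (F : free_resolution) (theta : 'cV[P]_(fr_rank F 2) -> E),
    let cocycle c := fr_diff F 2 *m c = 0 in
    [/\ forall a u v, cocycle u -> cocycle v ->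
          theta (a *: u + v) = phi a *: theta u + theta v,
        forall e, exists2 c, cocycle c & theta c = e &
        forall c, cocycle c ->
          (theta c = 0 <-> exists b, c = fr_diff F 1 *m b)].

End Ext2.

Section MonomialCurveRing.
Variables (k : fieldType) (n : nat) (a : n.-tuple nat).

Definition monomial_eval : {mpoly k[n]} -> {poly k} :=
  mmap (@polyC k) (fun i => 'X^(tnth a i)).
HB.instance Definition _ := GRing.RMorphism.on monomial_eval.

Definition curve_pred : {pred {poly k}} :=
  [pred p | `[< exists F, p = monomial_eval F >]].

Lemma curve_subring_closed : subring_closed curve_pred.
Proof.
split=> [|_ _ /asboolP[F ->] /asboolP[G ->]|_ _ /asboolP[F ->] /asboolP[G ->]];
  apply/asboolP.
- by exists 1; rewrite rmorph1.
- by exists (F - G); rewrite rmorphB.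
- by exists (F * G); rewrite rmorphM.
Qed.

HB.instance Definition _ := GRing.isSubringClosed.Build {poly k} curve_pred
  curve_subring_closed.

(* The subring [k[t^a_1, ..., t^a_n]] of [k[t]]. *)
Record curve_ring := CurveRing {
  curve_val :> {poly k};
  curve_valP : curve_val \in curve_pred
}.

HB.instance Definition _ := [isSub for curve_val].
HB.instance Definition _ := [Choice of curve_ring by <:].
HB.instance Definition _ := [SubChoice_isSubComNzRing of curve_ring by <:].

Lemma monomial_eval_in F : monomial_eval F \in curve_pred.
Proof. by apply/asboolP; exists F. Qed.

Definition curve_map (F : {mpoly k[n]}) : curve_ring :=
  CurveRing (monomial_eval_in F).

Lemma curve_map_zmod_morphism : zmod_morphism curve_map.
Proof. by move=> F G; apply: val_inj; rewrite /= rmorphB. Qed.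

Lemma curve_map_monoid_morphism : monoid_morphism curve_map.
Proof.
by split=> [|F G]; apply: val_inj; rewrite /= (rmorph1, rmorphM).
Qed.

HB.instance Definition _ := GRing.isZmodMorphism.Build
  {mpoly k[n]} curve_ring curve_map curve_map_zmod_morphism.
HB.instance Definition _ := GRing.isMonoidMorphism.Build
  {mpoly k[n]} curve_ring curve_map curve_map_monoid_morphism.

End MonomialCurveRing.

(* The graded canonical module of [P = k[X_1, ..., X_n]] is a shift of [P], so
   that, forgetting the grading and for [n = 3], the canonical module of the
   curve ring is [Ext^2_P(R, P)]. *)
Definition is_canonical_module (k : fieldType) (a : 3.-tuple nat)
    (omega : lmodType (curve_ring k a)) : Prop :=
  is_Ext2 (curve_map a) omega.

Definition herzog_matrix (k : fieldType)
    (alpha beta gamma alpha' beta' gamma' : nat) : 'M[{mpoly k[3]}]_(2, 3) :=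
  let X := 'X_(0 : 'I_3) in let Y := 'X_(1 : 'I_3) in
  let Z := 'X_(2 : 'I_3) in
  \matrix_(i < 2, j < 3)
    nth 0 (nth [::] [:: [:: X ^+ alpha;  Y ^+ beta;   Z ^+ gamma];
                        [:: Y ^+ beta';  Z ^+ gamma'; X ^+ alpha']] i) j.

(* Main.v *)
Require Import Defs.
From HB Require Import structures.
From mathcomp Require Import all_boot all_order all_algebra.
From mathcomp Require Import boolp mpoly ring zify.
Set Implicit Arguments.
Unset Strict Implicit.
Import GRing.Theory.
Local Open Scope ring_scope.

(** Let [x], [y], [z] be the images of the variables in the curve ring [R], and
    let [H] be its semigroup of exponents.

    The matrix and the column of its signed maximal minors form a free
    resolution of [R] of length 2 ([hilbert_burch]).  Since [Ext] does not
    depend on the resolution ([is_Ext2_resolution]), the canonical module is the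
    cokernel of the matrix: it has two generators [e1], [e2] and the three
    relations given by the columns ([canonical_module_presentation]).  In
    particular [x^alpha e1 + y^beta' e2 = 0], so the image of a linear map to
    [R] is an ideal [J = (f1, f2)] with [x^alpha f1 + y^beta' f2 = 0].  One such map
    sends [e1] to [y^beta'] and [e2] to [-x^alpha]; its image is the ideal
    [K = (x^alpha, y^beta')].

    The ring [R/K] has the basis of monomials [x^i y^j z^l] with [i < alpha],
    [j < beta'] and [l < gamma + gamma'], so it has length at most
    [alpha beta' (gamma + gamma')] ([chain_bound]).  The exponents of these
    monomials are exactly the elements of [H] that are not exponents of
    monomials of [K] ([mem_box]).  This rests on [unique_factorization]: a
    monomial divisible by none of the six terms of the minors is determined by
    its degree, because such a monomial occurs in no element of the kernel.

    It remains to see that no [J] gives a smaller length.  The field [k] is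
    arbitrary and [J] need not be homogeneous, so orders of vanishing at [t = 0]
    are used rather than degrees or dimensions: each element of [H] which is not
    the order of an element of [J] is a step in a chain of submodules of [R/J]
    ([chain_of_orders]).  By the relation between [f1] and [f2], the orders of
    the elements of [J] lie in the set of exponents of [K] translated by
    [ord f2 - a1 alpha].  If this integer is nonnegative, the translate has
    at least as large a complement in [H] as the set of exponents of [K]
    ([size_gaps_shift]), which is the desired bound.  It is nonnegative
    ([order_bound]): otherwise a monomial of [R] of degree [ord f2 < a1 alpha],
    multiplied by [y^beta'], would have the degree of a multiple of [x^alpha].
    By minimality of [a1 alpha] none of the six terms divides this product, so
    [unique_factorization] makes [x^alpha] divide a monomial of degree less than
    [a1 alpha]. *)

(** * Independence of Ext of the free resolution *)

Section Ext2Independence.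
Variables (P R : comNzRingType) (phi : {rmorphism P -> R}).

(** A matrix whose rows are combinations of the rows of [D] is a left multiple
    of [D]. *)
Lemma mx_factor (m n p : nat) (A : 'M[P]_(m, n)) (D : 'M[P]_(p, n)) :
  (forall i, exists w, row i A = w *m D) -> exists B, A = B *m D.
Proof.
move=> /(@fin_all_exists _ _ _)[w wE].
by exists (\matrix_i w i); apply/row_matrixP => i; rewrite row_mul rowK wE.
Qed.

Lemma resolution_lift (F : free_resolution phi) m i
    (A : 'M[P]_(m, fr_rank F i.+1)) :
  A *m fr_diff F i = 0 -> exists B, A = B *m fr_diff F i.+1.
Proof.
move=> A0; apply: mx_factor => j; apply/fr_exactS.
by rewrite -row_mul A0 row0.
Qed.

Lemma resolution_lift0 (F : free_resolution phi) m
    (A : 'M[P]_(m, fr_rank F 0)) :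
  (forall j, fr_aug (row j A) = 0) -> exists B, A = B *m fr_diff F 0.
Proof. by move=> A0; apply: mx_factor => j; apply/fr_exact0. Qed.

Lemma resolution_diffM (F : free_resolution phi) i :
  fr_diff F i.+1 *m fr_diff F i = 0.
Proof.
apply/row_matrixP => j; rewrite row_mul row0; apply/fr_exactS.
by exists (delta_mx 0 j); rewrite -rowE.
Qed.

Lemma resolution_aug_diff (F : free_resolution phi) w :
  fr_aug (w *m fr_diff F 0) = 0.
Proof. by apply/fr_exact0; exists w. Qed.

Lemma fr_aug0 (F : free_resolution phi) : fr_aug (0 : 'rV_(fr_rank F 0)) = 0.
Proof. by apply/fr_exact0; exists 0; rewrite mul0mx. Qed.

Lemma fr_augD (F : free_resolution phi) (u v : 'rV_(fr_rank F 0)) :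
  fr_aug (u + v) = fr_aug u + fr_aug v.
Proof. by rewrite -{1}[u]scale1r fr_aug_linear rmorph1 mul1r. Qed.

Lemma fr_augZ (F : free_resolution phi) a (v : 'rV_(fr_rank F 0)) :
  fr_aug (a *: v) = phi a * fr_aug v.
Proof. by rewrite -[a *: v]addr0 fr_aug_linear fr_aug0 addr0. Qed.

Lemma fr_augB (F : free_resolution phi) (u v : 'rV_(fr_rank F 0)) :
  fr_aug (u - v) = fr_aug u - fr_aug v.
Proof. by rewrite -scaleN1r fr_augD fr_augZ rmorphN1 mulN1r. Qed.

Lemma fr_aug_sum (F : free_resolution phi) n (c : 'rV[P]_n)
    (A : 'M[P]_(n, fr_rank F 0)) :
  fr_aug (c *m A) = \sum_j phi (c 0 j) * fr_aug (row j A).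
Proof.
rewrite mulmx_sum_row (big_morph _ (@fr_augD F) (@fr_aug0 F)).
by apply: eq_bigr => j _; rewrite fr_augZ.
Qed.

(** The start of a chain map lifting the identity of [R]. *)
Lemma chain_map_exists (F G : free_resolution phi) :
  exists U0 : 'M[P]_(fr_rank F 0, fr_rank G 0),
  exists U1 : 'M[P]_(fr_rank F 1, fr_rank G 1),
  exists U2 : 'M[P]_(fr_rank F 2, fr_rank G 2),
  exists U3 : 'M[P]_(fr_rank F 3, fr_rank G 3),
  [/\ forall v, fr_aug (v *m U0) = fr_aug v,
      fr_diff F 0 *m U0 = U1 *m fr_diff G 0,
      fr_diff F 1 *m U1 = U2 *m fr_diff G 1 &
      fr_diff F 2 *m U2 = U3 *m fr_diff G 2].
Proof.
have [w wE] : exists w : 'I_(fr_rank F 0) -> 'rV[P]_(fr_rank G 0),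
    forall j, fr_aug (w j) = fr_aug (delta_mx 0 j : 'rV_(fr_rank F 0)).
  apply: (fin_all_exists (P := fun j w => fr_aug w = _)) => j.
  exact: fr_aug_surj.
pose U0 := \matrix_j w j.
have augU0 v : fr_aug (v *m U0) = fr_aug v.
  rewrite -[v in RHS]mulmx1 !fr_aug_sum; apply: eq_bigr => j _.
  by rewrite rowK wE row1.
have [|U1 U1E] := @resolution_lift0 G _ (fr_diff F 0 *m U0).
  by move=> j; rewrite row_mul augU0 rowE resolution_aug_diff.
have [|U2 U2E] := @resolution_lift G _ 0 (fr_diff F 1 *m U1).
  by rewrite -mulmxA -U1E mulmxA resolution_diffM mul0mx.
have [|U3 U3E] := @resolution_lift G _ 1 (fr_diff F 2 *m U2).
  by rewrite -mulmxA -U2E mulmxA resolution_diffM mul0mx.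
by exists U0, U1, U2, U3.
Qed.

(** A chain endomorphism lifting the identity of [R] is homotopic to the
    identity in degree 2. *)
Lemma chain_endo_homotopic (F : free_resolution phi)
    (W0 : 'M[P]_(fr_rank F 0)) (W1 : 'M[P]_(fr_rank F 1))
    (W2 : 'M[P]_(fr_rank F 2)) :
  (forall v, fr_aug (v *m W0) = fr_aug v) ->
  fr_diff F 0 *m W0 = W1 *m fr_diff F 0 ->
  fr_diff F 1 *m W1 = W2 *m fr_diff F 1 ->
  exists S1 S2, W2 = 1%:M + fr_diff F 1 *m S1 + S2 *m fr_diff F 2.
Proof.
move=> augW W01 W12.
have [|S0 S0E] := @resolution_lift0 F _ (W0 - 1%:M).
  by move=> j; rewrite rowE mulmxBr fr_augB augW mulmx1 subrr.
have [|S1 S1E] := @resolution_lift F _ 0 (W1 - 1%:M - fr_diff F 0 *m S0).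
  rewrite !mulmxBl -W01 mul1mx -mulmxA -S0E mulmxBr mulmx1.
  exact: subrr.
have [|S2 S2E] := @resolution_lift F _ 1 (W2 - 1%:M - fr_diff F 1 *m S1).
  rewrite !mulmxBl -W12 mul1mx -mulmxA -S1E !mulmxBr mulmx1 mulmxA.
  by rewrite resolution_diffM mul0mx subr0 subrr.
by exists S1, S2; rewrite -S2E [RHS]addrC -[W2 - _ - _]addrA -opprD subrK.
Qed.

(** [Ext^2_P(R, P)] can be computed from any free resolution of [R]. *)
Lemma is_Ext2_resolution (E : lmodType R) (G : free_resolution phi) :
  is_Ext2 phi E ->
  exists theta : 'cV[P]_(fr_rank G 2) -> E,
    let cocycle c := fr_diff G 2 *m c = 0 in
    [/\ forall a u v, cocycle u -> cocycle v ->
          theta (a *: u + v) = phi a *: theta u + theta v,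
        forall e, exists2 c, cocycle c & theta c = e &
        forall c, cocycle c ->
          (theta c = 0 <-> exists b, c = fr_diff G 1 *m b)].
Proof.
case=> F [theta [/= theta_lin theta_surj theta_ker]].
have [U0 [U1 [U2 [U3 [augU U01 U12 U23]]]]] := chain_map_exists F G.
have [V0 [V1 [V2 [V3 [augV V01 V12 V23]]]]] := chain_map_exists G F.
have [||| S1 [S2 VU]] :=
  @chain_endo_homotopic G (V0 *m U0) (V1 *m U1) (V2 *m U2).
- by move=> v; rewrite mulmxA augU augV.
- by rewrite mulmxA V01 -!mulmxA U01.
- by rewrite mulmxA V12 -!mulmxA U12.
have [||| T1 [T2 UV]] :=
  @chain_endo_homotopic F (U0 *m V0) (U1 *m V1) (U2 *m V2).
- by move=> v; rewrite mulmxA augV augU.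
- by rewrite mulmxA U01 -!mulmxA V01.
- by rewrite mulmxA U12 -!mulmxA V12.
have cocU c : fr_diff G 2 *m c = 0 -> fr_diff F 2 *m (U2 *m c) = 0.
  by move=> c0; rewrite mulmxA U23 -mulmxA c0 mulmx0.
have cocV c : fr_diff F 2 *m c = 0 -> fr_diff G 2 *m (V2 *m c) = 0.
  by move=> c0; rewrite mulmxA V23 -mulmxA c0 mulmx0.
exists (fun c => theta (U2 *m c)); split=> /=.
- move=> a u v u0 v0; rewrite mulmxDr -scalemxAr.
  by rewrite theta_lin //; apply: cocU.
- move=> e; have [c c0 <-] := theta_surj e; exists (V2 *m c); first exact: cocV.
  have cob : theta (fr_diff F 1 *m (T1 *m c)) = 0.
    apply/theta_ker; last by exists (T1 *m c).
    by rewrite mulmxA resolution_diffM mul0mx.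
  rewrite mulmxA UV !mulmxDl mul1mx -[T2 *m _ *m _]mulmxA c0 mulmx0 addr0.
  rewrite -mulmxA addrC -[X in theta (X + _)]scale1r theta_lin //.
    by rewrite cob scaler0 add0r.
  by rewrite mulmxA resolution_diffM mul0mx.
- move=> c c0; rewrite (theta_ker _ (cocU _ _ c0)); split=> [[b Ub]|[b ->]].
    exists (V1 *m b - S1 *m c); rewrite mulmxBr !mulmxA.
    have := congr1 (mulmx V2) Ub.
    rewrite !mulmxA VU -V12 !mulmxDl mul1mx -[S2 *m _ *m _]mulmxA c0 mulmx0.
    rewrite addr0.
    by move=> <-; rewrite addrK.
  by exists (U1 *m b); rewrite !mulmxA U12.
Qed.

End Ext2Independence.

(** * Syzygies of the minors and binomials in three variables *)

(** The Hilbert-Burch syzygy argument for a 2 x 3 matrix over a domain, when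
    two of its minors form a regular sequence. *)
Lemma minor_syzygy (P : idomainType) (x1 x2 x3 y1 y2 y3 : P) :
  let D1 := x2 * y3 - x3 * y2 in
  let D2 := x3 * y1 - x1 * y3 in
  let D3 := x1 * y2 - x2 * y1 in
  D1 != 0 ->
  (forall w w', D3 * w = D1 * w' -> exists u, w = D1 * u) ->
  forall p q r, p * D1 + q * D2 + r * D3 = 0 ->
  exists u v, [/\ p = u * x1 + v * y1, q = u * x2 + v * y2
                & r = u * x3 + v * y3].
Proof.
move=> D1 D2 D3 D1_neq0 D13_reg p q r pqr.
(* Cramer's rule, first on the last two columns, then on the first two *)
have [|u uE] := D13_reg (q * y3 - r * y2) (p * y2 - q * y1).
  apply/eqP; rewrite -subr_eq0 -(mulr0 (- y2)) -pqr; apply/eqP.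
  by rewrite /D1 /D2 /D3; ring.
have [|v vE] := D13_reg (x2 * r - x3 * q) (x1 * q - x2 * p).
  apply/eqP; rewrite -subr_eq0 -(mulr0 x2) -pqr; apply/eqP.
  by rewrite /D1 /D2 /D3; ring.
exists u, v; split; apply: (mulfI D1_neq0); rewrite mulrDr !mulrA -uE -vE.
- apply/eqP; rewrite -subr_eq0 -pqr; apply/eqP.
  by rewrite /D1 /D2 /D3; ring.
- by rewrite /D1; ring.
- by rewrite /D1; ring.
Qed.

(** A nonzero constant is not a zero divisor modulo a monic polynomial. *)
Lemma monic_dvd_constM (A : idomainType) (D : {poly A}) (a : A)
    (w h : {poly A}) :
  D \is monic -> a != 0 -> a *: w = D * h -> exists q, w = D * q.
Proof.
move=> monD a_neq0 aw; exists (Pdiv.Ring.rdivp w D).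
have wE := Pdiv.RingMonic.rdivp_eq monD w.
set q := Pdiv.Ring.rdivp w D in wE *; set r := Pdiv.Ring.rmodp w D in wE.
have [r0|r_neq0] := eqVneq r 0; first by rewrite wE r0 addr0 mulrC.
have szr : (size r < size D)%N by rewrite Pdiv.Ring.ltn_rmodpN0 // monic_neq0.
have arE : a *: r = D * (h - a *: q).
  by rewrite mulrBr -aw {1}wE -scalerAr scalerDr [D * q]mulrC addrC addKr.
have ar_neq0 : a *: r != 0.
  by rewrite -size_poly_eq0 size_scale // size_poly_eq0.
have hq_neq0 : h - a *: q != 0.
  by apply: contraNneq ar_neq0 => hq0; rewrite arE hq0 mulr0.
have szar : size (a *: r) = size r by rewrite size_scale.
move: szr; rewrite -szar arE size_monicM // -ltnS.
by rewrite -size_poly_gt0 in hq_neq0; lia.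
Qed.

Section LastVariable.
Variables (k : fieldType) (n : nat).

(** The map [muni] views a polynomial in [n + 1] variables as a univariate
    polynomial in the last one; [ununi] undoes this by substituting the last
    variable. *)
Definition ununi (p : {poly {mpoly k[n]}}) : {mpoly k[n.+1]} :=
  (mpwiden p).['X_ord_max].

Lemma ununiM p q : ununi (p * q) = ununi p * ununi q.
Proof. by rewrite /ununi rmorphM hornerM. Qed.

Lemma muniK : cancel (@muni n k) ununi.
Proof.
move=> p; rewrite muniE /ununi rmorph_sum horner_sum [RHS]mpolyE.
apply: eq_bigr => m _; rewrite /= mpwidenZ hornerZ mwidenZ -scalerAl.
congr (_ *: _).
rewrite rmorphXn /= mpwidenX hornerXn mwidenX mpolyXn -mpolyXD; congr 'X_[_].
apply/mnmP => i; rewrite mnmDE mulmnE mnm1E.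
case: (unliftP ord_max i) => [j|] ->.
  have -> : lift ord_max j = widen_ord (leqnSn n) j.
    by apply: val_inj; rewrite /= /bump leqNgt ltn_ord.
  rewrite mnmwiden_widen mnmE.
  have -> : (ord_max == widen_ord (leqnSn n) j) = false.
    by apply/negbTE; rewrite -val_eqE /= neq_ltn ltn_ord orbT.
  by rewrite mul0n addn0.
by rewrite mnmwiden_ordmax eqxx mul1n.
Qed.

End LastVariable.

Section ThreeVariables.
Variable k : fieldType.
Local Notation P := {mpoly k[3]}.
Local Notation X := ('X_0 : P).
Local Notation Y := ('X_1 : P).
Local Notation Z := ('X_2 : P).

(** The exponent of the monomial [X^i Y^j Z^l]. *)
Definition mon (i j l : nat) : 'X_{1..3} :=
  (U_((0 : 'I_3)%R) *+ i + U_((1 : 'I_3)%R) *+ j + U_((2 : 'I_3)%R) *+ l)%MM.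

Lemma monE i j l : 'X_[mon i j l] = X ^+ i * Y ^+ j * Z ^+ l.
Proof. by rewrite /mon !mpolyXD -!mpolyXn. Qed.

Lemma mon0 i j l : mon i j l 0 = i.
Proof. by rewrite /mon !mnmDE !mulmnE !mnm1E /=; lia. Qed.

Lemma mon1 i j l : mon i j l 1 = j.
Proof. by rewrite /mon !mnmDE !mulmnE !mnm1E /=; lia. Qed.

Lemma mon2 i j l : mon i j l 2 = l.
Proof. by rewrite /mon !mnmDE !mulmnE !mnm1E /=; lia. Qed.

Let muniXn (p : P) i : muni (p ^+ i) = muni p ^+ i.
Proof. exact: rmorphXn. Qed.

Lemma muni_X : muni X = ('X_0)%:P.
Proof.
rewrite muniE msuppX big_seq1 mcoeffX eqxx scale1r mnm1E /= expr0 alg_polyC.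
by congr ('X_[_])%:P; apply/mnmP => i; rewrite mnmE !mnm1E -!val_eqE.
Qed.

Lemma muni_Y : muni Y = ('X_1)%:P.
Proof.
rewrite muniE msuppX big_seq1 mcoeffX eqxx scale1r mnm1E /= expr0 alg_polyC.
by congr ('X_[_])%:P; apply/mnmP => i; rewrite mnmE !mnm1E -!val_eqE.
Qed.

Lemma muni_Z : muni Z = 'X.
Proof.
rewrite muniE msuppX big_seq1 mcoeffX eqxx scale1r mnm1E /= expr1.
rewrite (_ : [multinom _ | _ < _] = 0%MM) ?mpolyX0 ?scale1r //.
by apply/mnmP => i; rewrite mnmE mnm1E mnm0E -val_eqE /=; case: i => [[|[]]].
Qed.

(** [Y^b X^a' - Z^c] and [X^a Z^c' - Y^b'] form a regular sequence: modulo the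
    first one, a multiple of the second one is a nonzero polynomial in [X] and
    [Y], over which the quotient is free. *)
Lemma binomial_regular (a a' b b' c c' : nat) (w w' : P) :
  (0 < a)%N -> (0 < b')%N -> (0 < c)%N ->
  (X ^+ a * Z ^+ c' - Y ^+ b') * w = (Y ^+ b * X ^+ a' - Z ^+ c) * w' ->
  exists u, w = (Y ^+ b * X ^+ a' - Z ^+ c) * u.
Proof.
move=> a_gt0 b'_gt0 c_gt0 eqw.
set D1 := Y ^+ b * X ^+ a' - Z ^+ c in eqw *.
pose e := X ^+ (a * c) * (Y ^+ b * X ^+ a') ^+ c' - Y ^+ (b' * c).
(* modulo [D1], where [Z^c = Y^b X^a'], the polynomial [e] is the difference of
   the [c]-th powers of the two terms of the second binomial *)
have [v ev] : exists v, e * w = D1 * v.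
  pose s := \sum_(i < c) (X ^+ a * Z ^+ c') ^+ (c.-1 - i) * (Y ^+ b') ^+ i.
  pose t := \sum_(i < c') (Y ^+ b * X ^+ a') ^+ (c'.-1 - i) * (Z ^+ c) ^+ i.
  have D3s : (X ^+ a * Z ^+ c') ^+ c - (Y ^+ b') ^+ c
             = (X ^+ a * Z ^+ c' - Y ^+ b') * s by exact: subrXX.
  have D1t : (Y ^+ b * X ^+ a') ^+ c' - (Z ^+ c) ^+ c' = D1 * t.
    exact: subrXX.
  exists (s * w' + X ^+ (a * c) * t * w).
  have -> : e = X ^+ (a * c) * (D1 * t) + (X ^+ a * Z ^+ c' - Y ^+ b') * s.
    rewrite -D3s -D1t /e (exprMn _ (X ^+ a)) -(exprM X) -(exprM Y).
    have -> : (Z ^+ c) ^+ c' = (Z ^+ c') ^+ c by rewrite -!exprM mulnC.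
    by ring.
  rewrite mulrDl -[_ * s * w]mulrAC eqw; ring.
pose A := {mpoly k[2]}.
pose x : A := 'X_0; pose y : A := 'X_1.
pose e2 : A := x ^+ (a * c) * (y ^+ b * x ^+ a') ^+ c' - y ^+ (b' * c).
pose D : {poly A} := 'X^c - (y ^+ b * x ^+ a')%:P.
have muni_e : muni e = e2%:P.
  by rewrite /e muniB !(muniM, muniXn) muni_X muni_Y /e2 polyCB
     !(polyCM, polyC_exp).
have muni_D1 : muni D1 = - D.
  by rewrite /D1 muniB !(muniM, muniXn) muni_X muni_Y muni_Z /D opprB
     polyCM !polyC_exp.
have e2_neq0 : e2 != 0.
  apply/eqP => /(congr1 (mcoeff (U_(1) *+ (b' * c)))).
  rewrite mcoeffB mcoeff0 /e2 /x /y exprMn -!exprM mulrCA -exprD !mpolyXn.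
  rewrite -mpolyXD !mcoeffX eqxx; case: eqP => [/mnmP/(_ 0)|_].
    by rewrite mnmDE !mulmnE !mnm1E /=; lia.
  by move/eqP; rewrite sub0r oppr_eq0 oner_eq0.
have [||q wq] := @monic_dvd_constM A D e2 (muni w) (- muni v) _ e2_neq0.
- by rewrite monicXnsubC.
- have := congr1 (@muni 2 k) ev.
  by rewrite !muniM muni_e muni_D1 mul_polyC mulrN mulNr.
exists (ununi (- q)).
by rewrite -[w]muniK -[D1]muniK -ununiM muni_D1 mulrNN -wq.
Qed.

End ThreeVariables.

(** * The Hilbert-Burch resolution *)

Lemma ord2P (i : 'I_2) : i = 0 \/ i = 1.
Proof. by case: i => [[|[|//]] lti]; [left|right]; apply: val_inj. Qed.

Lemma ord3P (i : 'I_3) : [\/ i = 0, i = 1 | i = 2].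
Proof.
by case: i => [[|[|[|//]]] lti];
  [apply: Or31|apply: Or32|apply: Or33]; apply: val_inj.
Qed.

Lemma det_mx22 (R : comNzRingType) (A : 'M[R]_2) :
  \det A = A 0 0 * A 1 1 - A 0 1 * A 1 0.
Proof.
rewrite (expand_det_row _ 0) !big_ord_recl big_ord0 addr0 /cofactor.
rewrite !det_mx11 !mxE /= expr0 expr1 mul1r mulN1r mulrN.
by congr (A _ _ * A _ _ - A _ _ * A _ _); apply: val_inj.
Qed.

Section ColumnCombination.
Variables (R : comNzRingType) (n : nat) (c : 'cV[R]_n).

(** The linear combinations of the entries of a column; its image is the ideal
    that they generate. *)
Definition col_comb (v : 'rV[R]_n) : R^o := (v *m c) 0 0.

Lemma col_comb_linear : linear col_comb.
Proof. by move=> b u v; rewrite /col_comb mulmxDl -scalemxAl !mxE. Qed.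

HB.instance Definition _ :=
  GRing.isLinear.Build R 'rV[R]_n R^o _ col_comb col_comb_linear.

End ColumnCombination.

Section HilbertBurch.
Variables (k : fieldType) (a : 3.-tuple nat).
Variables alpha beta gamma alpha' beta' gamma' : nat.
Hypotheses (alpha_gt0 : (0 < alpha)%N) (beta_gt0 : (0 < beta)%N).
Hypotheses (gamma_gt0 : (0 < gamma)%N) (alpha'_gt0 : (0 < alpha')%N).
Hypotheses (beta'_gt0 : (0 < beta')%N) (gamma'_gt0 : (0 < gamma')%N).
Hypothesis ker_eq : forall F : {mpoly k[3]},
  curve_map a F = 0 <->
  minor_ideal 2 (herzog_matrix k alpha beta gamma alpha' beta' gamma') F.

Local Notation P := {mpoly k[3]}.
Local Notation X := ('X_0 : P).
Local Notation Y := ('X_1 : P).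
Local Notation Z := ('X_2 : P).
Local Notation M := (herzog_matrix k alpha beta gamma alpha' beta' gamma').

(** The signed maximal minors, that is, the cross product of the two rows. *)
Definition minor1 : P := Y ^+ beta * X ^+ alpha' - Z ^+ gamma * Z ^+ gamma'.
Definition minor2 : P := Z ^+ gamma * Y ^+ beta' - X ^+ alpha * X ^+ alpha'.
Definition minor3 : P := X ^+ alpha * Z ^+ gamma' - Y ^+ beta * Y ^+ beta'.

Definition minor_col : 'cV[P]_3 := \col_j nth 0 [:: minor1; minor2; minor3] j.

Lemma mulmx_minor_col (v : 'rV[P]_3) :
  (v *m minor_col) 0 0 =
    v 0 0 * minor1 + v 0 1 * minor2 + v 0 2 * minor3.
Proof.
rewrite mxE !big_ord_recl big_ord0 addr0 !mxE /= addrA.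
by congr (v _ _ * _ + v _ _ * _ + v _ _ * _); apply: val_inj.
Qed.

Lemma mulmx_herzog (w : 'rV[P]_2) :
  [/\ (w *m M) 0 0 = w 0 0 * X ^+ alpha + w 0 1 * Y ^+ beta',
      (w *m M) 0 1 = w 0 0 * Y ^+ beta + w 0 1 * Z ^+ gamma' &
      (w *m M) 0 2 = w 0 0 * Z ^+ gamma + w 0 1 * X ^+ alpha'].
Proof.
split; rewrite mxE !big_ord_recl big_ord0 addr0 !mxE /=;
  by congr (w _ _ * _ + w _ _ * _); apply: val_inj.
Qed.


Lemma minor_idealP F :
  minor_ideal 2 M F <->
  exists p q r, F = p * minor1 + q * minor2 + r * minor3.
Proof.
have ME i j : M i j = nth 0 (nth [::]
    [:: [:: X ^+ alpha;  Y ^+ beta;   Z ^+ gamma];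
        [:: Y ^+ beta';  Z ^+ gamma'; X ^+ alpha']] i) j by rewrite mxE.
have combE p q r : p * minor1 + q * minor2 + r * minor3 =
    col_comb minor_col (\row_j nth 0 [:: p; q; r] j).
  by rewrite /col_comb mulmx_minor_col !mxE.
split=> [MF|[p [q [r ->]]] N sub_N].
  have : F \in linimage (col_comb minor_col).
    apply: MF => x [f [g [f_mono g_mono ->]]]; rewrite det_mx22.
    have mem y p q r : y = p * minor1 + q * minor2 + r * minor3 ->
        y \in linimage (col_comb minor_col).
      move=> ->; rewrite combE; apply/asboolP.
      by exists (\row_j nth 0 [:: p; q; r] j).
    rewrite !(mxE _ _ 0) !(mxE _ _ 1).
    have [-> ->] : f 0 = 0 /\ f 1 = 1.
      have := f_mono 0 1 isT.
      by case: (ord2P (f 0)) => ->; case: (ord2P (f 1)) => ->.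
    have := g_mono 0 1 isT.
    case: (ord3P (g 0)) => ->; case: (ord3P (g 1)) => -> // _.
    - by apply: (mem _ 0 0 1); rewrite !ME /= /minor3; ring.
    - by apply: (mem _ 0 (-1) 0); rewrite !ME /= /minor2; ring.
    - by apply: (mem _ 1 0 0); rewrite !ME /= /minor1; ring.
  case/asboolP=> v ->; exists (v 0 0), (v 0 1), (v 0 2).
  exact: mulmx_minor_col.
have mem (j1 j2 : 'I_3) : (j1 < j2)%N ->
    M 0 j1 * M 1 j2 - M 0 j2 * M 1 j1 \in N.
  move=> ltj; apply: sub_N; exists id, (fun i => if i == 0 then j1 else j2).
  split=> //; last by rewrite det_mx22 !mxE.
  by move=> i1 i2; case: (ord2P i1) => ->; case: (ord2P i2) => ->.
have scale u x : x \in N -> u * x \in N by apply: (@rpredZ _ _ N u).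
have := scale r _ (mem 0 1 isT); have := scale (- q) _ (mem 0 2 isT).
have := scale p _ (mem 1 2 isT); rewrite !ME /=.
move=> N1 N2 N3; have := rpredD (rpredD N1 N2) N3.
rewrite [X in X \in N](_ : _ = p * minor1 + q * minor2 + r * minor3) //.
by rewrite /minor1 /minor2 /minor3; ring.
Qed.

Lemma minor1E : minor1 = 'X_[mon alpha' beta 0] - 'X_[mon 0 0 (gamma + gamma')].
Proof. by rewrite /minor1 !monE exprD; ring. Qed.

Lemma minor2E :
  minor2 = 'X_[mon 0 beta' gamma] - 'X_[mon (alpha + alpha') 0 0].
Proof. by rewrite /minor2 !monE exprD; ring. Qed.

Lemma minor3E :
  minor3 = 'X_[mon alpha 0 gamma'] - 'X_[mon 0 (beta + beta') 0].
Proof. by rewrite /minor3 !monE exprD; ring. Qed.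

Lemma minor1_neq0 : minor1 != 0.
Proof.
apply/eqP => /(congr1 (mcoeff (mon alpha' beta 0))).
rewrite minor1E mcoeffB mcoeff0 !mcoeffX eqxx; case: eqP => [/mnmP/(_ 0)|_].
  by rewrite !mon0; lia.
by move/eqP; rewrite subr0 oner_eq0.
Qed.

Lemma herzog_minor_col : M *m minor_col = 0.
Proof.
apply/row_matrixP => i; rewrite row0 rowE mulmxA.
apply/rowP => j; rewrite ord1 mulmx_minor_col [RHS]mxE.
have [-> -> ->] := mulmx_herzog (delta_mx 0 i).
by rewrite /minor1 /minor2 /minor3; ring.
Qed.

Lemma herzog_syzygy (v : 'rV[P]_3) :
  v *m minor_col = 0 -> exists w, v = w *m M.
Proof.
move=> /rowP/(_ 0); rewrite mulmx_minor_col [RHS]mxE => v0.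
have [||u [u' [v0E v1E v2E]]] := @minor_syzygy _ (X ^+ alpha) (Y ^+ beta)
    (Z ^+ gamma) (Y ^+ beta') (Z ^+ gamma') (X ^+ alpha') _ _ _ _ _ v0.
- exact: minor1_neq0.
- move=> w w'; rewrite -!exprD; apply: binomial_regular => //; lia.
exists (\row_j nth 0 [:: u; u'] j).
set w := \row_j _; have [w0 w1 w2] := mulmx_herzog w.
apply/rowP => j; case: (ord3P j) => ->.
- by rewrite w0 !mxE v0E.
- by rewrite w1 !mxE v1E.
- by rewrite w2 !mxE v2E.
Qed.

Lemma herzog_inj (w : 'rV[P]_2) : w *m M = 0 -> w = 0.
Proof.
move=> wM0; have [] := mulmx_herzog w; rewrite wM0 !mxE.
set y := Y ^+ beta; set z := Z ^+ gamma; set z' := Z ^+ gamma'.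
set x' := X ^+ alpha' => _ /esym eq1 /esym eq2.
have w00 : minor1 * w 0 0 = 0.
  transitivity (x' * (w 0 0 * y + w 0 1 * z') - z' * (w 0 0 * z + w 0 1 * x')).
    by rewrite /minor1 -/x' -/y -/z -/z'; ring.
  by rewrite eq1 eq2 !mulr0 subrr.
have w01 : minor1 * w 0 1 = 0.
  transitivity (y * (w 0 0 * z + w 0 1 * x') - z * (w 0 0 * y + w 0 1 * z')).
    by rewrite /minor1 -/x' -/y -/z -/z'; ring.
  by rewrite eq1 eq2 !mulr0 subrr.
have cancel1 u : minor1 * u = 0 -> u = 0.
  by move/eqP; rewrite mulf_eq0 (negbTE minor1_neq0) => /eqP.
apply/rowP => j; rewrite mxE.
by case: (ord2P j) => ->; apply: cancel1.
Qed.

(** The resolution [0 -> P^2 -> P^3 -> P] of the curve ring: the matrix, then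
    the column of its minors. *)
Definition hb_rank (i : nat) : nat :=
  match i with 0 => 1 | 1 => 3 | 2 => 2 | _ => 0 end.

Definition hb_diff (i : nat) : 'M[P]_(hb_rank i.+1, hb_rank i) :=
  match i return 'M[P]_(hb_rank i.+1, hb_rank i) with
  | 0 => minor_col | 1 => M | _ => 0
  end.

Definition hb_aug (v : 'rV[P]_(hb_rank 0)) : curve_ring k a :=
  curve_map a (v 0 0).

Lemma hb_aug_linear b u v :
  hb_aug (b *: u + v) = curve_map a b * hb_aug u + hb_aug v.
Proof. by rewrite /hb_aug !mxE rmorphD rmorphM. Qed.

Lemma curve_map_surj (r : curve_ring k a) : exists F, curve_map a F = r.
Proof.
case: r => p p_in; have /asboolP[F pF] := p_in.
by exists F; apply: val_inj.
Qed.

Lemma hb_aug_surj r : exists v, hb_aug v = r.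
Proof.
by have [F <-] := curve_map_surj r; exists (const_mx F); rewrite /hb_aug mxE.
Qed.

Lemma hb_exact0 v : hb_aug v = 0 <-> exists w, v = w *m hb_diff 0.
Proof.
rewrite /hb_aug ker_eq minor_idealP; split=> [[p [q [r vE]]]|[w ->]].
  exists (\row_j nth 0 [:: p; q; r] j); apply/rowP => j.
  by rewrite ord1 mulmx_minor_col !mxE.
by exists (w 0 0), (w 0 1), (w 0 2); apply: mulmx_minor_col.
Qed.

Lemma hb_exactS i (v : 'rV[P]_(hb_rank i.+1)) :
  v *m hb_diff i = 0 <-> exists w, v = w *m hb_diff i.+1.
Proof.
case: i v => [|[|[|i]]] v /=.
- split=> [/herzog_syzygy //|[w ->]].
  by rewrite -mulmxA herzog_minor_col mulmx0.
- split=> [/herzog_inj ->|[w ->]]; first by exists 0; rewrite mulmx0.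
  by rewrite mulmx0 mul0mx.
- by split=> _; [exists 0; apply/rowP; case|rewrite mulmx0].
- by split=> _; [exists 0; apply/rowP; case|rewrite mulmx0].
Qed.

Definition hilbert_burch : free_resolution (curve_map a) :=
  FreeResolution hb_aug_linear hb_aug_surj hb_exact0 hb_exactS.

(** The canonical module is the cokernel of the matrix, acting on columns. *)
Lemma canonical_module_presentation (omega : lmodType (curve_ring k a)) :
  is_canonical_module omega ->
  exists theta : 'cV[P]_2 -> omega,
    [/\ forall b u v, theta (b *: u + v) = curve_map a b *: theta u + theta v,
        forall e, exists c, theta c = e &
        forall c, theta c = 0 <-> exists b, c = M *m b].
Proof.
move=> /(is_Ext2_resolution hilbert_burch) /= [theta [lin surj ker]].
have cocycle (c : 'cV[P]_2) : (0 : 'M_(0, 2)) *m c = 0 by rewrite mul0mx.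
exists theta; split.
- by move=> b u v; apply: lin; apply: cocycle.
- by move=> e; have [c _ <-] := surj e; exists c.
- by move=> c; apply: ker; apply: cocycle.
Qed.

End HilbertBurch.

(** * Maps from a presented module *)

Section Presentation.
Variables (P R : comNzRingType) (phi : {rmorphism P -> R}) (n : nat).
Variables (M : lmodType R) (theta : 'cV[P]_n -> M).
Hypothesis phi_surj : forall r, exists F, phi F = r.
Hypothesis theta_lin : forall b u v,
  theta (b *: u + v) = phi b *: theta u + theta v.
Hypothesis theta_surj : forall e, exists c, theta c = e.

(** A semilinear map vanishing on the kernel of a presentation factors through
    the presented module. *)
Lemma presentation_factor (h : 'cV[P]_n -> R^o) :
  (forall b u v, h (b *: u + v) = phi b *: h u + h v) ->
  (forall c, theta c = 0 -> h c = 0) ->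
  exists f : {linear M -> R^o}, forall c, f (theta c) = h c.
Proof.
move=> h_lin h_ker; have [g gK] := choice theta_surj.
have h_eq c c' : theta c = theta c' -> h c = h c'.
  move=> eqc; have := h_ker (-1 *: c' + c).
  rewrite theta_lin h_lin rmorphN1 eqc !scaleN1r addNr => /(_ erefl) h0.
  by apply/eqP; rewrite -subr_eq0 addrC h0.
pose f e : R^o := h (g e).
have f_lin : linear f.
  move=> r e e'; have [F <-] := phi_surj r.
  by rewrite /f -h_lin; apply: h_eq; rewrite theta_lin !gK.
pose F : {linear M -> R^o} := HB.pack f (GRing.isLinear.Build _ _ _ _ f f_lin).
by exists F => c; apply: h_eq; rewrite gK.
Qed.

End Presentation.

(** * Extended natural numbers and orders of vanishing *)

Lemma enat_sup_ub (A : nat -> Prop) b n :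
  enat_sup A = Some b -> A n -> (n <= b)%N.
Proof.
rewrite /enat_sup; case: pselect => // ex [<-] An.
by case: ex_minnP => m /asboolP/(_ n An).
Qed.

Lemma enat_sup_max (A : nat -> Prop) b :
  A b -> (forall n, A n -> (n <= b)%N) -> enat_sup A = Some b.
Proof.
move=> Ab ubA; rewrite /enat_sup; case: pselect => [ex|]; last first.
  by case; exists b; apply/asboolP.
congr Some; case: ex_minnP => m /asboolP/(_ b Ab) le_bm min_m.
by apply/eqP; rewrite eqn_leq le_bm min_m //; apply/asboolP.
Qed.

Lemma enat_inf_min (A : option nat -> Prop) n :
  A (Some n) -> (forall m, A (Some m) -> (n <= m)%N) -> enat_inf A = Some n.
Proof.
move=> An lbA; rewrite /enat_inf; case: pselect => [ex|]; last first.
  by case; exists n; apply/asboolP.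
congr Some; case: ex_minnP => m /asboolP Am min_m.
by apply/eqP; rewrite eqn_leq lbA // min_m //; apply/asboolP.
Qed.

Lemma quotmod_pi0 (R : comNzRingType) (V : lmodType R) (N : submodClosed V) :
  quotmod_pi N 0 = 0.
Proof. by apply: (addrI (quotmod_pi N 0)); rewrite -quotmod_piD !addr0. Qed.

Section Order.
Variable k : fieldType.
Implicit Types p q : {poly k}.

(** The multiplicity of [0] as a root is the order of vanishing at [t = 0]. *)
Lemma mup0_factor p : p != 0 ->
  exists2 q : {poly k}, q`_0 != 0 & p = q * 'X^(mup 0 p).
Proof.
move=> p_neq0; have [m [q]] := multiplicity_XsubC p 0.
rewrite p_neq0 /= subr0 => q0 pE; exists q; first by rewrite -horner_coef0.
have -> : mup 0 p = m; last by [].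
by rewrite pE mupMr // -['X]subr0 mup_XsubCX eqxx.
Qed.

Lemma coef_mup0 p : p != 0 -> p`_(mup 0 p) != 0.
Proof.
by move=> /mup0_factor[q q0 pE]; rewrite {1}pE coefMXn ltnn subnn.
Qed.

Lemma mup0_eq p s :
  p`_s != 0 -> (forall i, (i < s)%N -> p`_i = 0) -> mup 0 p = s.
Proof.
move=> ps plow.
have p_neq0 : p != 0 by apply: contraNneq ps => ->; rewrite coef0.
apply/eqP; rewrite eqn_leq; apply/andP; split; rewrite leqNgt; apply/negP => lt.
  have [q _ pE] := mup0_factor p_neq0.
  by move: ps; rewrite pE coefMXn lt eqxx.
by move: (coef_mup0 p_neq0); rewrite plow ?eqxx.
Qed.

Lemma mup0_tpow s : mup 0 ('X^s : {poly k}) = s.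
Proof.
apply: mup0_eq => [|i lti]; rewrite coefXn ?eqxx ?oner_eq0 //.
by rewrite ltn_eqF.
Qed.

End Order.

(** * The numerical semigroup of exponents *)

Lemma mcoeffMX_eq0 (k : fieldType) n (p : {mpoly k[n]}) (m m' : 'X_{1..n}) i :
  (m i < m' i)%N -> (p * 'X_[m'])@_m = 0.
Proof.
move=> lti; apply: memN_msupp_eq0; apply/negP.
rewrite (perm_mem (msuppMX p m')) => /mapP[m1 _ mE].
by move: lti; rewrite mE mnmDE ltnNge leq_addr.
Qed.

Section Semigroup.
Variables (k : fieldType) (a1 a2 a3 : nat).
Local Notation a := [tuple a1; a2; a3].
Local Notation R := (curve_ring k a).

(** The weighted degree of [X^i Y^j Z^l], which is the exponent of its image. *)
Definition wdeg (i j l : nat) : nat := (a1 * i + a2 * j + a3 * l)%N.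

Lemma wdegD i j l i' j' l' :
  wdeg (i + i') (j + j') (l + l') = (wdeg i j l + wdeg i' j' l')%N.
Proof. by rewrite /wdeg; lia. Qed.

Lemma wdegX i : wdeg i 0 0 = (a1 * i)%N.
Proof. by rewrite /wdeg !muln0 !addn0. Qed.

Lemma wdegY j : wdeg 0 j 0 = (a2 * j)%N.
Proof. by rewrite /wdeg !muln0 addn0 add0n. Qed.

(** Membership in the numerical semigroup generated by the exponents. *)
Definition in_sg (s : nat) : bool :=
  `[< exists i j l, s = wdeg i j l >].

Lemma in_sgP s : reflect (exists i j l, s = wdeg i j l) (in_sg s).
Proof. exact: asboolP. Qed.

Lemma in_sg_wdeg i j l : in_sg (wdeg i j l).
Proof. by apply/in_sgP; exists i, j, l. Qed.

Lemma mmap1_tpow (m : 'X_{1..3}) :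
  mmap1 (fun i : 'I_3 => 'X^(tnth a i) : {poly k}) m =
  'X^(wdeg (m 0) (m 1) (m 2)).
Proof.
rewrite /mmap1 !big_ord_recl big_ord0 mulr1 -!exprM -!exprD /wdeg addnA.
rewrite !(tnth_nth 0%N) /=.
by congr ('X^(_ * m _ + _ * m _ + _ * m _)); apply: val_inj.
Qed.

Lemma monomial_eval_mon i j l :
  monomial_eval a 'X_[mon i j l] = 'X^(wdeg i j l) :> {poly k}.
Proof. by rewrite /monomial_eval mmapX mmap1_tpow mon0 mon1 mon2. Qed.

Lemma curve_map_mon i j l :
  \val (curve_map a 'X_[mon i j l] : R) = 'X^(wdeg i j l).
Proof. exact: monomial_eval_mon. Qed.

Lemma coef_in_sg (r : R) s : (\val r)`_s != 0 -> in_sg s.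
Proof.
case: r => p pR /=; have /asboolP[F ->] := pR => Fs.
suff [m ms] : exists m : 'X_{1..3}, s = wdeg (m 0) (m 1) (m 2).
  by rewrite ms in_sg_wdeg.
have [//|noF] := pselect (exists m : 'X_{1..3}, s = wdeg (m 0) (m 1) (m 2)).
move/eqP: Fs; case; rewrite /monomial_eval /mmap coef_sum.
rewrite big1 // => m _; rewrite mmap1_tpow coefCM coefXn.
by case: eqP => [sE|_]; [case: noF; exists m|rewrite mulr0].
Qed.

Lemma tpow_exists s : in_sg s -> exists r : R, \val r = 'X^s.
Proof.
by move=> /in_sgP[i [j [l ->]]]; eexists; apply: (curve_map_mon i j l).
Qed.

End Semigroup.

(** Shifting [K] to the right cannot decrease the size of its complement in
    [H]: if [B] lists the complement of [K], then the complement of the shift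
    has at least [size B] elements below some [n]. *)
Lemma size_gaps_shift (H K : pred nat) (B : seq nat) e :
  (forall s, K s -> H s) -> uniq B -> (forall s, (s \in B) = H s && ~~ K s) ->
  exists n, (size B <=
    size [seq s <- iota 0 n | H s && ~~ ((e <= s) && K (s - e))])%N.
Proof.
move=> KH uB BE; pose n := (\max_(s <- B) s).+1; exists n.
pose K' s := (e <= s)%N && K (s - e)%N.
have sizeB : size B = count (fun s => H s && ~~ K s) (iota 0 n).
  rewrite -size_filter; apply/perm_size/uniq_perm => //.
    exact/filter_uniq/iota_uniq.
  move=> s; rewrite mem_filter -BE mem_iota /= add0n andb_idr // => sB.
  by rewrite ltnS; apply: leq_bigmax_seq.
have cH : count H (iota 0 n) = (count K (iota 0 n) + size B)%N.
  rewrite sizeB -(count_predUI K) [X in (_ + X)%N](@eq_count _ _ pred0).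
    rewrite count_pred0 addn0; apply: eq_count => s /=.
    by case Ks: (K s) => /=; [apply: KH|rewrite andbT].
  by move=> s /=; case: (K s) => //=; rewrite andbF.
have cK' : (count K' (iota 0 n) <= count K (iota 0 n))%N.
  have [le_en|lt_ne] := leqP e n; last first.
    rewrite (@eq_in_count _ _ pred0) ?count_pred0 // => s.
    by rewrite mem_iota /K' /=; lia.
  rewrite -{1}(subnKC le_en) iotaD count_cat (@eq_in_count _ _ pred0 (iota 0 e)).
    rewrite count_pred0 !add0n.
    have -> : iota e (n - e) = map (addn e) (iota 0 (n - e)).
      by rewrite -iotaDl addn0.
    rewrite count_map.
    rewrite (@eq_count _ _ K) => [|s]; last by rewrite /K' /= leq_addr addKn.
    rewrite -[X in (_ <= count K (iota 0 X))%N](subnK le_en) iotaD count_cat.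
    exact: leq_addr.
  by move=> s; rewrite mem_iota /K' /=; lia.
have : (count H (iota 0 n) <=
    count (fun s => H s && ~~ K' s) (iota 0 n) + count K' (iota 0 n))%N.
  rewrite -count_predUI (leq_trans _ (leq_addr _ _)) //.
  by apply: sub_count => s /= ->; rewrite orNb.
rewrite cH size_filter => /leq_trans/(_ (leq_add (leqnn _) cK')).
by rewrite addnC leq_add2r.
Qed.

(** * Lengths of quotients of the curve ring *)

Section CurveLength.
Variables (k : fieldType) (a1 a2 a3 : nat).
Local Notation a := [tuple a1; a2; a3].
Local Notation R := (curve_ring k a).
Local Notation in_sg := (in_sg a1 a2 a3).
(** The constants of the curve ring. *)
Definition curve_const (c : k) : R := curve_map a c%:MP.

Lemma curve_constE c : \val (curve_const c) = c%:P.
Proof. by rewrite /= /monomial_eval mmapC. Qed.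

Variable J : submodClosed R^o.

(** The classes modulo [J] of the elements of order at least [m]. *)
Definition order_ge (m : nat) : {pred quotmod J} :=
  [pred q | `[< exists r : R, q = quotmod_pi J r /\
                 forall i, (i < m)%N -> (\val r)`_i = 0 >]].

Lemma order_ge_submod m : submod_closed (order_ge m).
Proof.
split=> [|b _ _ /asboolP[r [-> r_low]] /asboolP[r' [-> r'_low]]]; apply/asboolP.
  by exists 0; rewrite quotmod_pi0; split=> // i _; rewrite /= coef0.
exists (b * r + r'); split; first by rewrite quotmod_piD quotmod_piZ.
move=> i lti; rewrite /= coefD r'_low // addr0 coefM big1 // => j _.
by rewrite r_low ?mulr0 // (leq_ltn_trans (leq_subr _ _)).
Qed.

HB.instance Definition _ m :=
  GRing.isSubmodClosed.Build R (quotmod J) (order_ge m) (order_ge_submod m).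

(** Every order attained in the ring but not in [J] adds one to the length. *)
Lemma chain_of_orders (S : seq nat) (n : nat) :
  sorted ltn (rcons S n) -> (forall s, s \in S -> in_sg s) ->
  (forall r : R, r \in J -> \val r != 0 -> mup 0 (\val r) \notin S) ->
  exists N : nat -> submodClosed (quotmod J),
    forall i, (i < size S)%N -> submod_lt (N i) (N i.+1).
Proof.
move=> sortS sgS ordJ; pose t i := nth n (rcons S n) (size S - i).
exists (fun i => order_ge (t i) : submodClosed (quotmod J)) => i lti.
have lt_t : (t i.+1 < t i)%N.
  by apply: (sorted_ltn_nth ltn_trans n sortS); rewrite ?inE ?size_rcons; lia.
have tS : t i.+1 \in S.
  have lt_size : (size S - i.+1 < size S)%N.
    by rewrite ltn_subrL (leq_ltn_trans _ lti).
  by rewrite /t nth_rcons lt_size mem_nth.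
split=> [_ /asboolP[r [-> r_low]]|].
  apply/asboolP; exists r; split=> // j ltj.
  by apply: r_low; apply: ltn_trans lt_t.
have [r rE] := tpow_exists k (sgS _ tS).
exists (quotmod_pi J r).
  apply/asboolP; exists r; split=> // j ltj.
  by rewrite rE coefXn ltn_eqF.
apply/asboolP => -[r' [/quotmod_piP rr' r'_low]].
have low j : (j <= t i.+1)%N -> (\val (r - r'))`_j = (j == t i.+1)%:R.
  move=> lej; have -> : \val (r - r') = \val r - \val r' :> {poly k} by [].
  rewrite coefB rE coefXn r'_low ?subr0 //.
  exact: leq_ltn_trans lt_t.
have mupE : mup 0 (\val (r - r')) = t i.+1.
  apply: mup0_eq => [|j ltj]; rewrite low ?eqxx ?oner_eq0 // ?ltn_eqF //.
  exact: ltnW.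
have := ordJ _ rr'; rewrite mupE tS => /(_ _)/negP; apply => //.
apply/eqP => v0; have := low _ (leqnn _).
by rewrite v0 coef0 eqxx => /esym/eqP; rewrite oner_eq0.
Qed.

Lemma curve_val_sum (I : finType) (F : I -> R) :
  curve_val (\sum_i F i) = \sum_i curve_val (F i).
Proof. by apply: (big_morph (fun r : R => curve_val r)). Qed.

(** If [J] contains the elements without a coefficient of exponent in [B], then
    the quotient has length at most [size B]. *)
Lemma chain_bound (B : seq nat) (n : nat)
    (N : nat -> submodClosed (quotmod J)) :
  (forall r : R, (forall s, s \in B -> (\val r)`_s = 0) -> r \in J) ->
  (forall i, (i < n)%N -> submod_lt (N i) (N i.+1)) -> (n <= size B)%N.
Proof.
move=> JB chain; rewrite leqNgt; apply/negP => ltBn.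
have [x xP] : exists x : 'I_n -> R, forall i : 'I_n,
    quotmod_pi J (x i) \in N i.+1 /\ quotmod_pi J (x i) \notin N i.
  apply: (fin_all_exists (P := fun (i : 'I_n) (x : R) =>
    quotmod_pi J x \in N i.+1 /\ quotmod_pi J x \notin N i)) => i.
  have [_ [q qN qN']] := chain i (ltn_ord i).
  by exists (repr q : R); rewrite quotmod_pi_repr.
have mono i j : (i <= j)%N -> (j <= n)%N -> {subset N i <= N j}.
  elim: j => [|j IH]; first by rewrite leqn0 => /eqP-> _ z.
  rewrite leq_eqVlt => /orP[/eqP-> _ z //|lij ltj z /(IH lij (ltnW ltj))].
  by have [sub _] := chain j ltj; apply: sub.
(* more elements than coefficients: some nontrivial combination over [k] has no
   coefficient of exponent in [B], hence lies in [J]; its last term then lies in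
   the submodule that it was chosen to avoid *)
pose C := \matrix_(i < n, j < size B) (\val (x i))`_(nth 0%N B j).
have kerC : kermx C != 0.
  rewrite -mxrank_eq0 mxrank_ker subn_eq0 -ltnNge.
  exact: leq_ltn_trans (rank_leq_col C) ltBn.
pose u := nz_row (kermx C).
have uC : u *m C = 0 by apply/sub_kermxP; apply: nz_row_sub.
have u_neq0 : u != 0 by rewrite nz_row_eq0.
have [i0 ui0] : exists i, u 0 i != 0 by apply/rV0Pn.
case: (@arg_maxnP _ i0 (fun i => u 0 i != 0) (fun i => i : nat) ui0).
move=> i ui i_max.
pose y : R := \sum_j curve_const (u 0 j) * x j.
have yJ : y \in J.
  apply: JB => s sB; have ltB : (index s B < size B)%N by rewrite index_mem.
  have := congr1 (fun A : 'rV_(size B) => A 0 (Ordinal ltB)) uC.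
  rewrite !mxE; apply: etrans; rewrite /y [\val _]curve_val_sum coef_sum.
  apply: eq_bigr => j _.
  by rewrite mxE nth_index //= [monomial_eval _ _]curve_constE coefCM.
have [_ /negP] := xP i; apply.
have -> : quotmod_pi J (x i) = - (curve_const (u 0 i)^-1 *:
    \sum_(j | j != i) curve_const (u 0 j) *: quotmod_pi J (x j)).
  have y0 : quotmod_pi J y = 0.
    by rewrite -(quotmod_pi0 J); apply/quotmod_piP; rewrite subr0.
  have yE : quotmod_pi J y = \sum_j curve_const (u 0 j) *: quotmod_pi J (x j).
    rewrite /y (big_morph _ (@quotmod_piD _ _ J) (quotmod_pi0 J)).
    by apply: eq_bigr => j _; rewrite quotmod_piZ.
  rewrite (bigD1 i) //= y0 in yE.
  have cc : curve_const (u 0 i)^-1 * curve_const (u 0 i) = 1.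
    by rewrite /curve_const -rmorphM -mpolyCM mulVf // rmorph1.
  rewrite -[LHS]scale1r -cc -scalerA; apply/eqP.
  rewrite -subr_eq0 opprK -scalerDr.
  by rewrite -yE scaler0.
rewrite -scaleNr; apply: rpredZ; apply: rpred_sum => j ji.
have [uj|uj] := eqVneq (u 0 j) 0.
  by rewrite uj /curve_const mpolyC0 rmorph0 scale0r; apply: rpred0.
have [xj _] := xP j; apply: rpredZ; apply: mono xj; last exact: ltnW.
by rewrite ltn_neqAle val_eqE ji; apply: i_max.
Qed.

End CurveLength.

(** * The invariant of the canonical module *)

Section HerzogSemigroup.
Variables (k : fieldType) (a1 a2 a3 : nat).
Hypotheses (a1_gt0 : (0 < a1)%N) (a2_gt0 : (0 < a2)%N) (a3_gt0 : (0 < a3)%N).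
Variables alpha beta gamma alpha' beta' gamma' : nat.
Hypotheses (alpha_gt0 : (0 < alpha)%N) (beta_gt0 : (0 < beta)%N).
Hypotheses (gamma_gt0 : (0 < gamma)%N) (alpha'_gt0 : (0 < alpha')%N).
Hypotheses (beta'_gt0 : (0 < beta')%N) (gamma'_gt0 : (0 < gamma')%N).
Local Notation a := [tuple a1; a2; a3].
Local Notation R := (curve_ring k a).
Hypothesis ker_eq : forall F : {mpoly k[3]},
  curve_map a F = 0 <->
  minor_ideal 2 (herzog_matrix k alpha beta gamma alpha' beta' gamma') F.
Local Notation wdeg := (wdeg a1 a2 a3).
Local Notation in_sg := (in_sg a1 a2 a3).

(** A monomial which is divisible by none of the six terms of the minors is the
    only monomial of its degree. *)
Lemma unique_factorization i j l i' j' l' :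
  (i < alpha')%N || (j < beta)%N -> (l < gamma + gamma')%N ->
  (j < beta')%N || (l < gamma)%N -> (i < alpha + alpha')%N ->
  (i < alpha)%N || (l < gamma')%N -> (j < beta + beta')%N ->
  wdeg i j l = wdeg i' j' l' -> [/\ i = i', j = j' & l = l'].
Proof.
move=> c1 c2 c3 c4 c5 c6 eqdeg.
suff eqm : mon i j l = mon i' j' l'.
  by split; [rewrite -(mon0 i j l) eqm mon0|rewrite -(mon1 i j l) eqm mon1
            |rewrite -(mon2 i j l) eqm mon2].
have : curve_map a ('X_[mon i j l] - 'X_[mon i' j' l']) = 0 :> R.
  by apply: val_inj; rewrite rmorphB /= !monomial_eval_mon eqdeg subrr.
rewrite ker_eq minor_idealP minor1E minor2E minor3E => -[p [q [r]]].
move=> /(congr1 (mcoeff (mon i j l))).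
rewrite mcoeffB !mcoeffX eqxx; case: eqP => // _.
rewrite !mulrBr !(mcoeffD, mcoeffN).
have z x y z u : (i < x)%N || (j < y)%N || (l < z)%N ->
    (u * 'X_[mon x y z] : {mpoly k[3]})@_(mon i j l) = 0.
  move=> /orP[/orP[]|] lt; [apply: (@mcoeffMX_eq0 _ _ _ _ _ 0)
    |apply: (@mcoeffMX_eq0 _ _ _ _ _ 1)|apply: (@mcoeffMX_eq0 _ _ _ _ _ 2)].
  - by rewrite !mon0.
  - by rewrite !mon1.
  - by rewrite !mon2.
rewrite !z; try lia.
by rewrite !subr0 !addr0 => /eqP; rewrite oner_eq0.
Qed.

Lemma minor1_homogeneous : wdeg alpha' beta 0 = wdeg 0 0 (gamma + gamma').
Proof.
have : curve_map a (minor1 k beta gamma alpha' gamma') = 0 :> R.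
  by apply/ker_eq/minor_idealP; exists 1, 0, 0; rewrite !mul0r !addr0 mul1r.
move/(congr1 (fun r : R => (\val r)`_(wdeg alpha' beta 0))).
rewrite minor1E /= rmorphB /= !monomial_eval_mon coefB coef0 !coefXn eqxx.
by case: eqP => // _ /eqP; rewrite subr0 oner_eq0.
Qed.

Hypothesis alpha_min : forall c : nat,
   c \in [:: a1 * alpha; a2 * beta; a3 * gamma;
             a2 * beta'; a3 * gamma'; a1 * alpha']%N -> (a1 * alpha <= c)%N.

Let min_beta : (a1 * alpha <= a2 * beta)%N.
Proof. by apply: alpha_min; rewrite !inE eqxx !orbT. Qed.
Let min_gamma : (a1 * alpha <= a3 * gamma)%N.
Proof. by apply: alpha_min; rewrite !inE eqxx !orbT. Qed.

Let le_alpha : (alpha <= alpha')%N.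
Proof.
by rewrite -(leq_pmul2l a1_gt0); apply: alpha_min; rewrite !inE eqxx !orbT.
Qed.

(** The degrees of the monomials in the ideal [(x^alpha, y^beta')]. *)
Definition in_K (s : nat) : bool :=
  `[< exists i j l, (alpha <= i)%N || (beta' <= j)%N /\ s = wdeg i j l >].

Lemma in_KP s : reflect
  (exists i j l, (alpha <= i)%N || (beta' <= j)%N /\ s = wdeg i j l) (in_K s).
Proof. exact: asboolP. Qed.

Lemma in_K_sg s : in_K s -> in_sg s.
Proof. by move=> /in_KP[i [j [l [_ ->]]]]; apply: in_sg_wdeg. Qed.

(** A monomial of the box is divisible by none of the six terms, since
    [alpha <= alpha']. *)
Lemma box_unique i j l i' j' l' :
  (i < alpha)%N -> (j < beta')%N -> (l < gamma + gamma')%N ->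
  wdeg i j l = wdeg i' j' l' -> [/\ i = i', j = j' & l = l'].
Proof.
by move=> lti ltj ltl; apply: unique_factorization => //; move: le_alpha; lia.
Qed.

(** The degrees of the monomials [x^i y^j z^l] with [i < alpha], [j < beta'] and
    [l < gamma + gamma']. *)
Definition box : seq nat :=
  codom (fun t : 'I_alpha * 'I_beta' * 'I_(gamma + gamma') =>
    wdeg t.1.1 t.1.2 t.2).

Lemma size_box : size box = (alpha * beta' * (gamma + gamma'))%N.
Proof. by rewrite size_codom !card_prod !card_ord. Qed.

Lemma box_uniq : uniq box.
Proof.
rewrite map_inj_uniq ?enum_uniq // => -[[i j] l] [[i' j'] l'] /= eqw.
have [] := box_unique (ltn_ord i) (ltn_ord j) (ltn_ord l) eqw.
by move=> /val_inj-> /val_inj-> /val_inj->.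
Qed.

(** The exponents outside [(x^alpha, y^beta')] are those of the box: a factor
    [z^(gamma + gamma')] can be replaced by [y^beta x^alpha'], which is a multiple
    of [x^alpha]. *)
Lemma mem_box s : (s \in box) = in_sg s && ~~ in_K s.
Proof.
apply/codomP/andP => [[[[i j] l] ->] /=|[/in_sgP[i [j [l sE]]] sK]].
  split; first exact: in_sg_wdeg.
  apply/in_KP => -[i' [j' [l' [ij' eqw]]]].
  have [ii jj _] := box_unique (ltn_ord i) (ltn_ord j) (ltn_ord l) eqw.
  by move: ij'; rewrite -ii -jj leqNgt ltn_ord leqNgt ltn_ord.
have [ltl|lel] := ltnP l (gamma + gamma').
  have [lti|lei] := ltnP i alpha; last first.
    by case/in_KP: sK; exists i, j, l; rewrite lei.
  have [ltj|lej] := ltnP j beta'; last first.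
    by case/in_KP: sK; exists i, j, l; rewrite lej orbT.
  by exists (Ordinal lti, Ordinal ltj, Ordinal ltl).
case/in_KP: sK; exists (i + alpha')%N, (j + beta)%N, (l - (gamma + gamma'))%N.
split; first by rewrite (leq_trans le_alpha) ?leq_addl.
have := wdegD a1 a2 a3 i j (l - (gamma + gamma')) alpha' beta 0.
by rewrite minor1_homogeneous -wdegD !addn0 subnK // -sE => ->.
Qed.

(** Applied to the orders [s] of [f2] and [s1] of [f1] when
    [x^alpha f1 + y^beta' f2 = 0]. *)
Lemma order_bound s s1 :
  in_sg s -> in_sg s1 -> (s1 + a1 * alpha = s + a2 * beta')%N ->
  (a1 * alpha <= s)%N.
Proof.
move=> /in_sgP[i [j [l sE]]] /in_sgP[i' [j' [l' s1E]]] eqs.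
rewrite leqNgt; apply/negP => lts.
have lti : (i < alpha)%N.
  by rewrite -(ltn_pmul2l a1_gt0); move: lts; rewrite sE /wdeg; lia.
have ltj : (j < beta)%N.
  rewrite -(ltn_pmul2l a2_gt0) (leq_trans _ min_beta) //.
  by move: lts; rewrite sE /wdeg; lia.
have ltl : (l < gamma)%N.
  rewrite -(ltn_pmul2l a3_gt0) (leq_trans _ min_gamma) //.
  by move: lts; rewrite sE /wdeg; lia.
have [|||||||iE _ _] :=
  @unique_factorization i (j + beta') l (i' + alpha) j' l'.
all: try by move: le_alpha; lia.
by move: eqs; rewrite sE s1E /wdeg; lia.
Qed.

Local Notation P := {mpoly k[3]}.
Local Notation phi := (@curve_map k 3 a).
Local Notation M := (herzog_matrix k alpha beta gamma alpha' beta' gamma').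

(** The order of an element of the ideal [(x^alpha, y^beta')] is the exponent of
    a monomial of this ideal. *)
Lemma order_in_K (r r' : R) :
  let z := curve_val r * 'X^(a1 * alpha) + curve_val r' * 'X^(a2 * beta') in
  z != 0 -> in_K (mup 0 z).
Proof.
move=> z z_neq0; have := coef_mup0 z_neq0; rewrite {2}/z coefD.
set s := mup 0 z; rewrite !coefMXn => zs.
have [rs|rs] := eqVneq (if (s < a1 * alpha)%N then 0
    else (curve_val r)`_(s - a1 * alpha)) 0.
  move: zs; rewrite rs add0r; case: ltnP => [_|le_s r's]; first by rewrite eqxx.
  have /in_sgP[i [j [l sE]]] := coef_in_sg (r := r') r's.
  apply/in_KP; exists i, (j + beta')%N, l; split.
    by rewrite leq_addl orbT.
  by rewrite -(subnK le_s) sE -(wdegY a1 a2 a3) -wdegD !addn0.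
move: rs; case: ltnP => [_|le_s rs]; first by rewrite eqxx.
have /in_sgP[i [j [l sE]]] := coef_in_sg (r := r) rs.
apply/in_KP; exists (i + alpha)%N, j, l; split; first by rewrite leq_addl.
by rewrite -(subnK le_s) sE -(wdegX a1 a2 a3) -wdegD !addn0.
Qed.

(** If [x^alpha f1 + y^beta' f2 = 0] then the orders of the elements of the ideal
    [(f1, f2)] lie in a translate to the right of the orders of the elements of
    [(x^alpha, y^beta')]. *)
Lemma order_relation_ideal (f1 f2 r1 r2 : R) :
  let z := curve_val r1 * curve_val f1 + curve_val r2 * curve_val f2 in
  let e := (mup 0 (curve_val f2) - a1 * alpha)%N in
  'X^(a1 * alpha) * curve_val f1 + 'X^(a2 * beta') * curve_val f2 = 0 ->
  z != 0 -> (e <= mup 0 z)%N && in_K (mup 0 z - e).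
Proof.
move=> z e rel z_neq0.
have tX_neq0 s : ('X^s : {poly k}) != 0 by rewrite monic_neq0 ?monicXn.
have f1E : 'X^(a1 * alpha) * curve_val f1 = - ('X^(a2 * beta') * curve_val f2).
  by apply/eqP; rewrite -addr_eq0 rel.
pose w := curve_val r2 * 'X^(a1 * alpha) + curve_val (- r1) * 'X^(a2 * beta').
have zE : z * 'X^(a1 * alpha) = curve_val f2 * w.
  transitivity (curve_val r1 * ('X^(a1 * alpha) * curve_val f1)
                + curve_val r2 * curve_val f2 * 'X^(a1 * alpha)).
    by rewrite /z; ring.
  by rewrite f1E /w /=; ring.
have : z * 'X^(a1 * alpha) != 0 by rewrite mulf_neq0.
rewrite zE mulf_eq0 negb_or => /andP[f2_neq0 w_neq0].
have f1_neq0 : curve_val f1 != 0.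
  apply/eqP => f10; move/eqP: f1E; rewrite f10 mulr0 eq_sym oppr_eq0 mulf_eq0.
  by rewrite (negbTE f2_neq0) (negbTE (tX_neq0 _)).
have ord_z : (mup 0 z + a1 * alpha = mup 0 (curve_val f2) + mup 0 w)%N.
  by rewrite -mupM // -zE mupM // mup0_tpow.
have mupN p : mup 0 (- p) = mup 0 p :> nat.
  by rewrite -scaleN1r -mul_polyC mupMr // rootC oppr_eq0 oner_eq0.
have le_f2 : (a1 * alpha <= mup 0 (curve_val f2))%N.
  apply: order_bound.
  - exact: (coef_in_sg (coef_mup0 f2_neq0)).
  - exact: (coef_in_sg (coef_mup0 f1_neq0)).
  rewrite -(mup0_tpow k (a1 * alpha)) -mupM // mulrC f1E mupN mupM //.
  by rewrite mup0_tpow addnC.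
have -> : mup 0 z = (e + mup 0 w)%N by rewrite /e; lia.
by rewrite leq_addr addKn; apply: order_in_K.
Qed.

(** An ideal which contains the monomials of [(x^alpha, y^beta')] contains the
    elements whose coefficients vanish on the box. *)
Lemma mem_of_box_vanish (J : submodClosed R^o) (r : R) :
  (forall (s : nat) (z : R), in_K s -> curve_val z = 'X^s -> z \in J) ->
  (forall s, s \in box -> (curve_val r)`_s = 0) -> r \in J.
Proof.
move=> JK rbox.
have [z zP] : exists z : 'I_(size (curve_val r)) -> R, forall s,
    z s \in J /\ curve_val (z s) = (curve_val r)`_s *: 'X^s.
  apply: (fin_all_exists (P := fun (s : 'I_(size (curve_val r))) (z : R) =>
    z \in J /\ curve_val z = (curve_val r)`_s *: 'X^s)) => s.
  have [rs|rs] := eqVneq (curve_val r)`_s 0.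
    by exists 0; rewrite rs scale0r; split=> //; apply: rpred0.
  have sgs : in_sg s := coef_in_sg (r := r) rs.
  have sK : in_K s.
    apply: contraNT rs => sK; apply/eqP; apply: rbox.
    by rewrite mem_box sgs.
  have [t tE] := tpow_exists k sgs.
  exists (curve_const a1 a2 a3 (curve_val r)`_s * t); split.
    by apply: (@rpredZ _ _ J); apply: JK sK tE.
  by rewrite /= [monomial_eval _ _]curve_constE [curve_val t]tE mul_polyC.
have -> : r = \sum_s z s.
  apply: val_inj; rewrite [RHS]curve_val_sum /= -[LHS]coefK poly_def.
  by apply: eq_bigr => s _; rewrite (zP s).2.
by apply: rpred_sum => s _; apply: (zP s).1.
Qed.

(** Every image has colength at least [size box], and the image of the map
    [e1 |-> y^beta'], [e2 |-> -x^alpha] has colength exactly [size box]. *)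
Lemma h_invariant_canonical (omega : lmodType R) :
  is_canonical_module omega ->
  h_invariant omega = Some (alpha * beta' * (gamma + gamma'))%N.
Proof.
move=> omega_can.
have [theta [theta_lin theta_surj theta_ker]] :=
  canonical_module_presentation alpha_gt0 beta_gt0 gamma_gt0 alpha'_gt0
    beta'_gt0 gamma'_gt0 ker_eq omega_can.
rewrite -size_box.
(* the quotient by the image of any [f] has a chain of length [size box] *)
have long_chain (f : {linear omega -> R^o}) :
    exists N : nat -> submodClosed (quotmod (linimage f)),
      forall i, (i < size box)%N -> submod_lt (N i) (N i.+1).
  pose f1 : R := f (theta (delta_mx 0 0)).
  pose f2 : R := f (theta (delta_mx 1 0)).
  have f_theta c : f (theta c) = phi (c 0 0) * f1 + phi (c 1 0) * f2 :> R.
    have theta0 : theta 0 = 0 by apply/theta_ker; exists 0; rewrite mulmx0.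
    have -> : c = c 0 0 *: delta_mx 0 0 + (c 1 0 *: delta_mx 1 0 + 0).
      apply/colP => i; rewrite !mxE.
      by case: (ord2P i) => -> /=; rewrite ?mulr1 ?mulr0 ?addr0 ?add0r.
    by rewrite !theta_lin theta0 addr0 linearD !linearZ_LR !mxE /=
      ?mulr1 ?mulr0 ?addr0 ?add0r.
  have rel :
      'X^(a1 * alpha) * curve_val f1 + 'X^(a2 * beta') * curve_val f2 = 0.
    have : theta (M *m delta_mx 0 0) = 0.
      by apply/theta_ker; exists (delta_mx 0 0).
    move/(congr1 f); rewrite f_theta linear0 -colE !mxE /=.
    move/(congr1 (@curve_val k 3 a)) => /= <-.
    have eX := monomial_eval_mon k a1 a2 a3 alpha 0 0.
    have eY := monomial_eval_mon k a1 a2 a3 0 beta' 0.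
    rewrite monE !expr0 !mulr1 wdegX in eX.
    rewrite monE !expr0 mulr1 mul1r wdegY in eY.
    by rewrite -eX -eY.
  have [n le_n] := size_gaps_shift (mup 0 (curve_val f2) - a1 * alpha)
    in_K_sg box_uniq mem_box.
  set S := filter _ _ in le_n.
  have [||r|N N_chain] := @chain_of_orders k a1 a2 a3 (linimage f) S n.
  - rewrite (sorted_pairwise ltn_trans) pairwise_rcons.
    rewrite -(sorted_pairwise ltn_trans).
    rewrite (sorted_filter ltn_trans) ?iota_ltn_sorted // andbT.
    by apply/allP => s; rewrite mem_filter mem_iota => /andP[].
  - by move=> s; rewrite mem_filter => /andP[/andP[]].
  - move=> /asboolP[e ->]; have [c <-] := theta_surj e.
    rewrite f_theta => fc_neq0.
    have :=
      order_relation_ideal (r1 := phi (c 0 0)) (r2 := phi (c 1 0)) rel fc_neq0.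
    by rewrite mem_filter => ->; rewrite andbF.
  by exists N => i lti; apply/N_chain/(leq_trans lti).
pose x : R := phi ('X_0 ^+ alpha); pose y : R := phi ('X_1 ^+ beta').
(* the map whose image is [(x^alpha, y^beta')]; on the three columns of the
   matrix it vanishes because it takes the values [0], [- minor3], [minor2] *)
pose h (c : 'cV[P]_2) : R^o := phi (c 0 0) * y - phi (c 1 0) * x.
have [||f0 f0E] := @presentation_factor P R phi 2 omega theta
    (@curve_map_surj k a) theta_lin theta_surj h.
- move=> b u v; rewrite /h !mxE !rmorphD !rmorphM scalerBr /=.
  by rewrite /GRing.scale /=; ring.
- move=> c /theta_ker[b ->]; rewrite /h /x /y -!rmorphM -rmorphB.
  apply/ker_eq/minor_idealP; exists 0, (b 2 0), (- b 1 0).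
  rewrite !mxE !big_ord_recl !big_ord0 !addr0 !mxE /= /minor2 /minor3.
  rewrite (_ : lift ord0 ord0 = 1); last exact: val_inj.
  rewrite (_ : lift ord0 (lift ord0 ord0) = 2); last exact: val_inj.
  by ring.
have K_im s (z : R) : in_K s -> curve_val z = 'X^s -> z \in linimage f0.
  move=> /in_KP[i [j [l [ij sE]]]] zs; apply/asboolP.
  have [le_i|lt_i] := leqP alpha i.
    exists (theta (\col_t (if t == 0 then 0 else - 'X_[mon (i - alpha) j l]))).
    rewrite f0E /h !mxE /= rmorph0 mul0r sub0r rmorphN mulNr opprK /x.
    rewrite -rmorphM; apply: val_inj; rewrite /= zs sE.
    rewrite -(monomial_eval_mon k); congr (monomial_eval _ _).
    by rewrite !monE -{1}(subnK le_i) exprD; ring.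
  have le_j : (beta' <= j)%N by move: ij; rewrite leqNgt lt_i.
  exists (theta (\col_t (if t == 0 then 'X_[mon i (j - beta') l] else 0))).
  rewrite f0E /h !mxE /= rmorph0 mul0r subr0 /y.
  rewrite -rmorphM; apply: val_inj; rewrite /= zs sE.
  rewrite -(monomial_eval_mon k); congr (monomial_eval _ _).
  by rewrite !monE -{1}(subnK le_j) exprD; ring.
apply: enat_inf_min => [|m [f lenf]].
  exists f0; apply/esym/enat_sup_max; first exact: long_chain.
  move=> n [N N_chain]; apply: chain_bound N_chain => r r_box.
  exact: mem_of_box_vanish K_im r_box.
by apply: (enat_sup_ub (esym lenf)); apply: long_chain.
Qed.

End HerzogSemigroup.

Unset Implicit Arguments.
Set Strict Implicit.

Theorem theorem4p4 (k : fieldType) (a1 a2 a3 : nat)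
  (a1_gt0 : (0 < a1)%N) (a2_gt0 : (0 < a2)%N) (a3_gt0 : (0 < a3)%N)
  (a_gcd : gcdn (gcdn a1 a2) a3 = 1%N)
  (R_not_gorenstein : ~ gorenstein (curve_ring k [tuple a1; a2; a3]))
  (alpha beta gamma alpha' beta' gamma' : nat)
  (alpha_gt0 : (0 < alpha)%N) (beta_gt0 : (0 < beta)%N)
  (gamma_gt0 : (0 < gamma)%N) (alpha'_gt0 : (0 < alpha')%N)
  (beta'_gt0 : (0 < beta')%N) (gamma'_gt0 : (0 < gamma')%N)
  (ker_eq : forall F : {mpoly k[3]},
     curve_map [tuple a1; a2; a3] F = 0 <->
     minor_ideal 2 (herzog_matrix k alpha beta gamma alpha' beta' gamma') F)
  (alpha_min : forall c : nat,
     c \in [:: a1 * alpha; a2 * beta; a3 * gamma;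
               a2 * beta'; a3 * gamma'; a1 * alpha']%N ->
     (a1 * alpha <= c)%N)
  (omega : lmodType (curve_ring k [tuple a1; a2; a3]))
  (omega_canonical : is_canonical_module omega) :
  h_invariant omega = Some (alpha * beta' * (gamma + gamma'))%N.
Proof.
exact: (h_invariant_canonical a1_gt0 a2_gt0 a3_gt0 alpha_gt0 beta_gt0 gamma_gt0
  alpha'_gt0 beta'_gt0 gamma'_gt0 ker_eq alpha_min omega_canonical).
Qed.
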